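(* Let $\lambda,\kappa\ge0$, $\gamma>0$ and $\alpha\in[0,1]$, and let $\{(X_t,v_t):t\ge0\}$ be the run-and-tumble process on $\mathbb{Z}\times\{-1,1\}$ with parameters $(\lambda,\kappa,\gamma)$ (generator $L$ given in the context), started from $X_0=0$ with $v_0=1$ with probability $\alpha$ and $v_0=-1$ with probability $1-\alpha$. Then for all $q\in\mathbb{R}$ and $z>0$ the Fourier–Laplace transform $S(q,z)=\int_0^\infty\mathbb{E}\left(e^{iqX_t}\right)e^{-zt}\,dt$ equals $$S(q,z)=\frac{i\lambda(2\alpha-1)\sin(q)+2\gamma+z-(\lambda+2\kappa)(\cos(q)-1)}{\big(\gamma+z-(\lambda+2\kappa)(\cos(q)-1)\big)^2-\gamma^2+\lambda^2\sin^2(q)}.$$ In particular, for $\alpha=\tfrac12$, $$S(q,z)=\frac{2\gamma+z-(\lambda+2\kappa)(\cos(q)-1)}{\big(\gamma+z-(\lambda+2\kappa)(\cos(q)-1)\big)^2-\gamma^2+\lambda^2\sin^2(q)}.$$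
   Context: The run-and-tumble process with parameters $(\lambda,\kappa,\gamma)$ is the continuous-time Markov jump process on $\mathbb{Z}\times\{-1,1\}$ ($X_t$ is the position, $v_t$ the velocity) with generator $$Lf(x,v)=\lambda\big(f(x+v,v)-f(x,v)\big)+\kappa\big(f(x+1,v)+f(x-1,v)-2f(x,v)\big)+\gamma\big(f(x,-v)-f(x,v)\big).$$ *)

(* Defs.v *)
From HB Require Import structures.
From mathcomp Require Import all_boot all_order all_algebra.
From mathcomp Require Import all_classical all_reals all_analysis.
From mathcomp Require Import complex.

Set Implicit Arguments.
Unset Strict Implicit.
Unset Printing Implicit Defensive.

Import Order.TTheory GRing.Theory Num.Theory.
Import numFieldNormedType.Exports.

Local Open Scope classical_set_scope.
Local Open Scope ring_scope.
Local Open Scope complex_scope.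

(* The state space Z x {-1, 1} with the discrete sigma-algebra.  A velocity is
   encoded as a boolean: true is +1 and false is -1, so that negating the
   boolean changes the sign of the velocity. *)
Definition state : Type := (int * bool)%type.
HB.instance Definition _ := Choice.on state.
HB.instance Definition _ := isPointed.Build state (0, true).
HB.instance Definition _ := @isMeasurable.Build default_measure_display state
  (@discrete_measurable state) (@discrete_measurable0 state)
  (@discrete_measurableC state) (@discrete_measurableU state).

Definition vel (v : bool) : int := if v then 1 else -1.

Definition rt_generator (R : realType) (lambda kappa gamma : R)
    (f : state -> R) (y : state) : R :=
  let: (x, v) := y in
  lambda * (f (x + vel v, v) - f (x, v))
  + kappa * (f (x + 1, v) + f (x - 1, v) - 2 * f (x, v))
  + gamma * (f (x, ~~ v) - f (x, v)).

(* Time-homogeneous transition functions; only times t >= 0 are constrained. *)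
Definition transition_function (R : realType)
    (p : R -> R.-pker state ~> state) : Prop :=
  (forall (y : state) (A : set state), p 0 y A = \d_y A) /\
  (forall (s t : R) (y : state) (A : set state), 0 <= s -> 0 <= t ->
     p (s + t) y A = (\int[p s y]_u p t u A)%E).

Definition semigroup (R : realType) (p : R -> R.-pker state ~> state)
    (t : R) (f : state -> R) (y : state) : R :=
  \int[p t y]_u f u.

(* L is the infinitesimal generator of the semigroup of p on the Banach space
   of bounded functions with the supremum norm, with full domain. *)
Definition has_generator (R : realType) (p : R -> R.-pker state ~> state)
    (L : (state -> R) -> (state -> R)) : Prop :=
  forall f : state -> R, bounded_fun f ->
    {uniform, (fun (h : R) (y : state) =>
                 h^-1 * (semigroup p h f y - f y)) @ 0^'+ --> L f}.

Definition natural_filtration (R : realType) (d : measure_display)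
    (T : measurableType d) (P : probability T R) (Y : R -> {RV P >-> state})
    (s : R) : set (set T) :=
  <<s [set A | exists (u : R) (B : set state),
         [/\ 0 <= u, u <= s & A = Y u @^-1` B]] >>.

(* E[f (Y_(s+t)) | F_s] = (P_t f) (Y_s) almost surely, for bounded f, in terms
   of the integrals over the events of F_s that characterize the conditional
   expectation. *)
Definition markov_property (R : realType) (d : measure_display)
    (T : measurableType d) (P : probability T R) (Y : R -> {RV P >-> state})
    (p : R -> R.-pker state ~> state) : Prop :=
  forall (s t : R) (f : state -> R) (A : set T),
    0 <= s -> 0 <= t -> bounded_fun f -> natural_filtration Y s A ->
    \int[P]_(w in A) f (Y (s + t) w) = \int[P]_(w in A) semigroup p t f (Y s w).

(* Right-continuous step functions: being constant just after and just before
   each time leaves only finitely many jumps in each bounded time interval. *)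
Definition jump_path (R : realType) (y : R -> state) : Prop :=
  (forall t : R, 0 <= t -> \forall s \near t^'+, y s = y t) /\
  (forall t : R, 0 < t -> exists u : state, \forall s \near t^'-, y s = u).

Definition markov_jump_process (R : realType) (d : measure_display)
    (T : measurableType d) (P : probability T R) (Y : R -> {RV P >-> state})
    (L : (state -> R) -> (state -> R)) : Prop :=
  {ae P, forall w : T, jump_path (fun t : R => Y t w)} /\
  exists p : R -> R.-pker state ~> state,
    [/\ transition_function p, has_generator p L & markov_property Y p].

Definition run_and_tumble (R : realType) (lambda kappa gamma : R)
    (d : measure_display) (T : measurableType d) (P : probability T R)
    (Y : R -> {RV P >-> state}) : Prop :=
  markov_jump_process Y (rt_generator lambda kappa gamma).

Definition cexp (R : realType) (z : R[i]) : R[i] :=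
  (expR (complex.Re z))%:C * (cos (complex.Im z) +i* sin (complex.Im z)).

Definition cintegrable (R : realType) (d : measure_display)
    (T : measurableType d) (mu : {measure set T -> \bar R}) (D : set T)
    (f : T -> R[i]) : Prop :=
  mu.-integrable D (fun x => (complex.Re (f x))%:E) /\
  mu.-integrable D (fun x => (complex.Im (f x))%:E).

Definition cintegral (R : realType) (d : measure_display)
    (T : measurableType d) (mu : {measure set T -> \bar R}) (D : set T)
    (f : T -> R[i]) : R[i] :=
  (\int[mu]_(x in D) complex.Re (f x)) +i* (\int[mu]_(x in D) complex.Im (f x)).

Definition char_fun (R : realType) (d : measure_display)
    (T : measurableType d) (P : probability T R) (Y : R -> {RV P >-> state})
    (q t : R) : R[i] :=
  cintegral P setT (fun w => cexp ('i%C * (q * (Y t w).1%:~R)%:C)).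

Definition FL_integrand (R : realType) (d : measure_display)
    (T : measurableType d) (P : probability T R) (Y : R -> {RV P >-> state})
    (q z t : R) : R[i] :=
  char_fun Y q t * (expR (- (z * t)))%:C.

Definition fourier_laplace (R : realType) (d : measure_display)
    (T : measurableType d) (P : probability T R) (Y : R -> {RV P >-> state})
    (q z : R) : R[i] :=
  cintegral (@lebesgue_measure R) `[0, +oo[ (FL_integrand Y q z).

(* Main.v *)
Require Import Defs.
From HB Require Import structures.
From mathcomp Require Import all_boot all_order all_algebra.
From mathcomp Require Import all_classical all_reals all_analysis.
From mathcomp Require Import complex.
From mathcomp Require Import measurable_realfun ring lra.
Set Implicit Arguments.
Unset Strict Implicit.
Unset Printing Implicit Defensive.
Import Order.TTheory GRing.Theory Num.Theory.
Import numFieldNormedType.Exports.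
Local Open Scope classical_set_scope.
Local Open Scope ring_scope.
Local Open Scope complex_scope.

(** Write [u_f(t) = E f(Y_t)] for a bounded observable [f] and [L] for the
    generator.  By the Markov property the increment [u_f(t + h) - u_f(t)] is
    [E (P_h f - f)(Y_t)], and [(P_h f - f) / h] converges to [L f] uniformly on
    the state space, so [u_{L f}] is the right derivative of [u_f], uniformly
    in time ([mean_right_derivative]).  Such a [u_f] is Lipschitz at small
    scales, and the same holds for [u_{L f}]; hence [u_f] is C^1 with
    [u_f' = u_{L f}], and its Laplace transform satisfies the Kolmogorov forward
    equation in resolvent form ([laplace_generator]):
      [z * laplace u_f z - laplace u_{L f} z = E f(Y_0)].

    The four functions [cos (q x)], [sin (q x)], [v cos (q x)], [v sin (q x)]
    span an [L]-stable space ([rt_generator_wave]): they are the real and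
    imaginary parts of [e^{iqx}] and [v e^{iqx}].  With
    [k = (lambda + 2 kappa) (cos q - 1)], and [S], [D] the transforms of
    [E e^{iqX_t}] and [E (v_t e^{iqX_t})], the resolvent equations read
      [(z - k) S - i lambda (sin q) D = 1] and
      [(z - k + 2 gamma) D - i lambda (sin q) S = 2 alpha - 1].
    The determinant [(z - k) (z - k + 2 gamma) + (lambda sin q)^2] is positive
    since [k <= 0 < z], and eliminating [D] gives [S]. *)

(** * Functions with a uniform right derivative *)

(** Uniformity in [t] is what makes a one-sided estimate strong enough: applied
    at the base point [t - h] it also controls the left increment at [t]. *)
Definition uniform_right_derivative (R : realType) (u v : R -> R) : Prop :=
  forall e : R, 0 < e -> exists2 d : R, 0 < d &
    forall t h : R, 0 <= t -> 0 < h < d ->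
      `|u (t + h) - u t - h * v t| <= e * h.

(** The estimate with [e = 1], at the smaller of the two points. *)
Lemma right_derivative_lipschitz (R : realType) (u v : R -> R) (K : R) :
    uniform_right_derivative u v -> (forall t, `|v t| <= K) ->
  exists2 d : R, 0 < d & forall s t : R, 0 <= s -> 0 <= t -> `|s - t| < d ->
    `|u s - u t| <= (K + 1) * `|s - t|.
Proof.
move=> uv vK; have [d d0 ud] := uv _ (@ltr01 R).
exists d => // s t; wlog: s t / t < s.
  move=> H s0 t0 st; case: (ltgtP t s) => [ts|ts|->]; first exact: H.
    by rewrite distrC (distrC s); apply: H => //; rewrite distrC.
  by rewrite !subrr normr0 mulr0.
move=> ts s0 t0; rewrite gtr0_norm ?subr_gt0// => std.
have := ud t (s - t) t0; rewrite subr_gt0 ts std => /(_ isT).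
rewrite [t + _]addrC subrK mul1r => ust.
rewrite (le_trans (_ : _ <= `|u s - u t - (s - t) * v t| + `|(s - t) * v t|))//.
  by rewrite -[X in `|X| <= _](subrK ((s - t) * v t)) ler_normD.
rewrite [leRHS]mulrDl mul1r [leRHS]addrC lerD//.
rewrite normrM mulrC (gtr0_norm (_ : 0 < s - t)) ?subr_gt0//.
by rewrite ler_wpM2r// subr_ge0 ltW.
Qed.

Lemma right_derivative_continuous (R : realType) (u v : R -> R) (K : R) :
    uniform_right_derivative u v -> (forall t, `|v t| <= K) ->
  {within `[0, +oo[, continuous u}.
Proof.
move=> uv vK; have [d d0 ud] := right_derivative_lipschitz uv vK.
have K0 : 0 < K + 1 by rewrite ltr_wpDl// (le_trans _ (vK 0)).
apply/subspace_continuousP => t; rewrite /= in_itv/= andbT => t0.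
apply/cvgrPdist_le => e e0; near=> s.
have s0 : 0 <= s.
  near: s; apply: filterS (@withinT _ _ `[0, +oo[ _) => y /=.
  by rewrite in_itv/= andbT.
have std : `|t - s| < d.
  near: s; apply: cvg_within; exact: nbhsx_ballx.
have ste : `|t - s| < e / (K + 1).
  near: s; apply: cvg_within; apply: nbhsx_ballx; exact: divr_gt0.
rewrite (le_trans (ud _ _ _ _ _))//.
by rewrite mulrC -ler_pdivlMr// ltW.
Unshelve. all: end_near. Qed.

(** For [h < 0] the estimate is used at the base point [t + h], and continuity of
    [v] replaces [v (t + h)] by [v t]. *)
Lemma right_derivative_is_derive (R : realType) (u v : R -> R) (t : R) :
    uniform_right_derivative u v -> 0 < t -> {for t, continuous v} ->
  is_derive t 1 u (v t).
Proof.
move=> uv t0 vt.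
have uvt : h^-1 *: ((u \o shift t) (h *: 1) - u t) @[h --> 0^'] --> v t.
  apply/cvgrPdist_le => e e0.
  have [d d0 ud] := uv _ (divr_gt0 e0 (@ltr0n R 2)).
  have [c /= c0 vc] : \forall s \near t, `|v t - v s| <= e / 2.
    by move/cvgrPdist_le : vt; apply; exact: divr_gt0.
  near=> h.
  have h0 : h != 0 by near: h; exact: nbhs_dnbhs_neq.
  have hd : `|h| < d by near: h; exact: dnbhs0_lt.
  have hc : `|h| < c by near: h; exact: dnbhs0_lt.
  have ht : `|h| < t by near: h; exact: dnbhs0_lt.
  rewrite /= /GRing.scale/= mulr1.
  have -> : v t - h^-1 * (u (h + t) - u t) =
      - h^-1 * (u (h + t) - u t - h * v t) by field.
  rewrite normrM normrN normfV ler_pdivrMl ?normr_gt0// [leRHS]mulrC.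
  case: (ltgtP h 0) h0 => // [hlt|hgt] _.
    have th0 : 0 <= t + h.
      by move: ht; rewrite ltr0_norm//; lra.
    (* The base point is [t + h], which precedes [t] by [- h]. *)
    have := ud (t + h) (- h) th0; rewrite addrK oppr_gt0 hlt.
    move: hd hc; rewrite !(ltr0_norm hlt) => -> hc /(_ isT) H1.
    have /vc H2 : ball t c (t + h).
      by rewrite /ball/= opprD addNKr normrN ltr0_norm.
    rewrite [h + t]addrC.
    have -> : u (t + h) - u t - h * v t =
       - (u t - u (t + h) - - h * v (t + h)) + - h * (v t - v (t + h)) by ring.
    rewrite (le_trans (ler_normD _ _))// normrN normrM normrN (ltr0_norm hlt).
    rewrite [e](splitr e) mulrDl lerD// [leRHS]mulrC ler_wpM2l//.
    by rewrite oppr_ge0 ltW.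
  have := ud t h (ltW t0); rewrite hgt -(gtr0_norm hgt) hd => /(_ isT).
  rewrite (gtr0_norm hgt) [h + t]addrC => /le_trans; apply.
  rewrite (gtr0_norm hgt) ler_wpM2r ?(ltW hgt)//.
  by rewrite ler_pdivrMr// ler_peMr ?ltW// ltr1n.
by apply: DeriveDef; [apply: cvgP uvt|exact: cvg_lim uvt].
Unshelve. all: end_near. Qed.

(** * Laplace transform of a derivative *)

Definition laplace (R : realType) (u : R -> R) (z : R) : R :=
  \int[lebesgue_measure]_(t in `[0, +oo[) (u t * expR (- (z * t))).

Lemma cvg_expRN_mul (R : realType) (z : R) :
  0 < z -> expR (- (z * t)) @[t --> +oo] --> (0 : R).
Proof.
move=> z0; apply: (cvg_comp (fun t : R => z * t) (fun x => expR (- x))).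
  exact: (gt0_cvgMry z0).
exact: cvgr_expR.
Qed.

Lemma is_derive_expRN_mul (R : realType) (z t : R) :
  is_derive t 1 (fun t => expR (- (z * t))) (- z * expR (- (z * t))).
Proof.
apply: is_derive_eq.
by rewrite /GRing.scale/=; ring.
Qed.

Lemma continuous_expRN_mul (R : realType) (z : R) :
  continuous (fun t : R => expR (- (z * t))).
Proof.
move=> t; apply: differentiable_continuous; apply/derivable1_diffP.
by case: (is_derive_expRN_mul z t).
Qed.

(** The integrand is the derivative of [- (c / z + u t) e^{-zt}].  The constant
    [c] makes it nonnegative, so that the fundamental theorem of calculus on the
    half-line applies without any prior integrability. *)
Lemma ge0_integral_laplace (R : realType) (u v : R -> R) (c K z : R) : 0 < z ->
    {within `[0, +oo[, continuous u} -> {within `[0, +oo[, continuous v} ->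
    (forall t : R, 0 < t -> is_derive t 1 u (v t)) ->
    (forall t, `|u t| <= K) -> (forall t, 0 <= c + z * u t - v t) ->
  (\int[lebesgue_measure]_(t in `[0%R, +oo[)
     ((c + z * u t - v t) * expR (- (z * t)))%R%:E = (c / z + u 0)%R%:E)%E.
Proof.
move=> z0 cu cv du uK ge0.
have wce : {within `[0, +oo[, continuous (fun t : R => expR (- (z * t)))}.
  by apply: continuous_subspaceT; exact: continuous_expRN_mul.
pose F (t : R) := - (c / z + u t) * expR (- (z * t)).
have dF (t : R) : 0 < t ->
    is_derive t 1 F ((c + z * u t - v t) * expR (- (z * t))).
  move=> t0; have dut := du t t0; have de := is_derive_expRN_mul z t.
  apply: is_derive_eq; rewrite /GRing.scale/=.
  by field; rewrite gt_eqF.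
have cF : {within `[0, +oo[, continuous F}.
  move=> t; apply: cvgM; last exact: wce.
  by apply: cvgN; apply: cvgD; [exact: cvg_cst|exact: cu].
rewrite (@ge0_continuous_FTC2y _ _ F _ 0).
- by rewrite -EFinB /F mulr0 oppr0 expR0 mulr1 sub0r opprK.
- by move=> t _; rewrite mulr_ge0// expR_ge0.
- move=> t; apply: cvgM; last exact: wce.
  apply: cvgB; last exact: cv.
  by apply: cvgD; [exact: cvg_cst|apply: cvgMr; exact: cu].
- have M0 : 0 < `|c / z| + K + 1.
    by rewrite ltr_wpDl// addr_ge0// (le_trans _ (uK 0)).
  apply/cvgr0Pnorm_le => e e0; near=> t.
  have et : `|expR (- (z * t))| <= e / (`|c / z| + K + 1).
    near: t; move/cvgr0Pnorm_le : (cvg_expRN_mul z0); apply.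
    exact: divr_gt0.
  rewrite normrM normrN.
  have -> : e = (`|c / z| + K + 1) * (e / (`|c / z| + K + 1)).
    by rewrite [RHS]mulrC divfK ?gt_eqF.
  rewrite ler_pM// (le_trans (ler_normD _ _))// -addrA lerD2l.
  by rewrite ler_wpDr.
- by move=> t /dF [].
- by move/continuous_within_itvcyP : cF => [].
- move=> t; rewrite in_itv/= andbT => /dF dFt.
  by rewrite derive1E derive_val.
Unshelve. all: end_near. Qed.

(** The case [u = v = 0], [c = 1] of [ge0_integral_laplace]: its integral is
    finite. *)
Lemma integrable_expRN_mul (R : realType) (z : R) : 0 < z ->
  lebesgue_measure.-integrable `[0, +oo[ (EFin \o (fun t => expR (- (z * t)))).
Proof.
move=> z0.
have := @ge0_integral_laplace R (cst 0) (cst 0) 1 0 z z0.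
have c0 : {within `[0, +oo[, continuous (cst 0 : R -> R)}.
  by move=> t; exact: cvg_cst.
move=> /(_ c0 c0 (fun t _ => is_derive_cst 0 t 1)).
have -> : (fun t : R => ((1 + z * cst 0 t - cst 0 t) * expR (- (z * t)))%:E) =
    EFin \o (fun t : R => expR (- (z * t))).
  by apply/funext => t /=; rewrite mulr0 addr0 subr0 mul1r.
move=> H; apply/integrableP; split.
  apply/measurable_EFinP.
  apply: subspace_continuous_measurable_fun => //.
  by apply: continuous_subspaceT; exact: continuous_expRN_mul.
under eq_integral => t _ do rewrite /= ger0_norm ?expR_ge0//.
by rewrite H ?ltry// => t; rewrite /= ?normr0// mulr0 addr0 subr0.
Qed.

Lemma laplace_integrable (R : realType) (u : R -> R) (K z : R) : 0 < z ->
    {within `[0, +oo[, continuous u} -> (forall t, `|u t| <= K) ->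
  lebesgue_measure.-integrable `[0, +oo[
    (EFin \o (fun t => u t * expR (- (z * t)))).
Proof.
move=> z0 cu uK.
apply: le_integrable (integrableZl _ K (integrable_expRN_mul z0)) => //.
- apply/measurable_EFinP; apply: measurable_funM.
    exact: subspace_continuous_measurable_fun.
  apply: subspace_continuous_measurable_fun => //.
  by apply: continuous_subspaceT; exact: continuous_expRN_mul.
- move=> t _ /=; rewrite lee_fin !normrM ler_wpM2r//.
  exact: le_trans (uK t) (ler_norm K).
Qed.

(** Integration by parts on the half-line: [ge0_integral_laplace] with [c] large
    enough for positivity, minus the same identity for [u = v = 0]. *)
Lemma laplace_derivative (R : realType) (u v : R -> R) (K L z : R) : 0 < z ->
    {within `[0, +oo[, continuous u} -> {within `[0, +oo[, continuous v} ->
    (forall t : R, 0 < t -> is_derive t 1 u (v t)) ->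
    (forall t, `|u t| <= K) -> (forall t, `|v t| <= L) ->
  z * laplace u z - laplace v z = u 0.
Proof.
move=> z0 cu cv du uK vL.
have int_u := laplace_integrable z0 cu uK.
have int_v := laplace_integrable z0 cv vL.
have int_e := integrable_expRN_mul z0.
pose c := z * K + L.
have ge0 t : 0 <= c + z * u t - v t.
  have := uK t; have := vL t; rewrite !ler_norml => /andP[_ vt] /andP[ut _].
  have -> : c + z * u t - v t = z * (K + u t) + (L - v t) by rewrite /c; ring.
  apply: addr_ge0; last by rewrite subr_ge0.
  by apply: mulr_ge0; [exact: ltW|rewrite -lerBlDl sub0r].
have cste (a : R) : {within `[0, +oo[, continuous (cst a : R -> R)}.
  by move=> t; exact: cvg_cst.
have L0 : 0 <= L by exact: le_trans (vL 0).
have K0 : 0 <= K by exact: le_trans (uK 0).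
have c0 t : 0 <= c + z * (cst 0 : R -> R) t - (cst 0 : R -> R) t.
  by rewrite mulr0 addr0 subr0 addr_ge0// mulr_ge0// ltW.
have H1 : \int[lebesgue_measure]_(t in `[0, +oo[)
     ((c + z * u t - v t) * expR (- (z * t))) = c / z + u 0.
  by rewrite /Rintegral (ge0_integral_laplace z0 cu cv du uK ge0).
have H2 : \int[lebesgue_measure]_(t in `[0, +oo[)
     (c * expR (- (z * t))) = c / z.
  have := @ge0_integral_laplace R (cst 0) (cst 0) c 0 z z0 (cste 0) (cste 0)
    (fun t _ => is_derive_cst 0 t 1) (fun=> _) c0.
  rewrite /Rintegral => /(_ _)/= H.
  rewrite (_ : (fun _ => _) = fun t : R =>
      ((c + z * cst 0 t - cst 0 t) * expR (- (z * t)))%:E).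
    by rewrite H ?addr0// => t; rewrite normr0.
  by apply/funext => t /=; rewrite mulr0 addr0 subr0.
apply: (addrI (c / z)); rewrite -H1 -{1}H2 /laplace.
rewrite -RintegralZl// -RintegralB//; last exact: (integrableZl _ z int_u).
rewrite -RintegralD//; last 2 first.
- exact: (integrableZl _ c int_e).
- exact: (integrableB _ (integrableZl _ z int_u) int_v).
by apply: eq_Rintegral => t _; ring.
Qed.

(** * Expectations of bounded observables along a Markov process *)

Definition mean (R : realType) (d : measure_display) (T : measurableType d)
    (P : probability T R) (Y : R -> {RV P >-> state}) (f : state -> R) (t : R) :
    R :=
  \int[P]_w f (Y t w).

Lemma bounded_funP (R : realType) (f : state -> R) :
  bounded_fun f <-> exists M, forall y, `|f y| <= M.
Proof.
split=> [/pinfty_ex_gt0[M _ fM]|[M fM]]; first by exists M => y; exact: fM.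
exists M; split; first exact: num_real.
by move=> N MN y _ /=; rewrite (le_trans (fM y))// ltW.
Qed.

Lemma integrable_observable (R : realType) (d : measure_display)
    (T : measurableType d) (P : probability T R) (Y : R -> {RV P >-> state})
    (f : state -> R) (t : R) : bounded_fun f ->
  P.-integrable setT (EFin \o (fun w => f (Y t w))).
Proof.
move=> /bounded_funP[M fM]; apply: measurable_bounded_integrable => //.
- by rewrite ltey_eq fin_num_measure.
- by apply: (@measurableT_comp _ _ _ _ _ _ f) => // _ B _.
- exists M; split; first exact: num_real.
  by move=> N MN w _ /=; rewrite (le_trans (fM _))// ltW.
Qed.

Lemma mean_linear (R : realType) (d : measure_display)
    (T : measurableType d) (P : probability T R) (Y : R -> {RV P >-> state})
    (a b : R) (f g : state -> R) (t : R) : bounded_fun f -> bounded_fun g ->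
  mean Y (fun y => a * f y + b * g y) t = a * mean Y f t + b * mean Y g t.
Proof.
move=> bf bg; have intf := integrable_observable Y t bf.
have intg := integrable_observable Y t bg.
rewrite /mean RintegralD//; last 2 first.
- exact: (integrableZl _ a intf).
- exact: (integrableZl _ b intg).
by rewrite !RintegralZl.
Qed.

Lemma mean_le (R : realType) (d : measure_display)
    (T : measurableType d) (P : probability T R) (Y : R -> {RV P >-> state})
    (f : state -> R) (M t : R) : (forall y, `|f y| <= M) -> `|mean Y f t| <= M.
Proof.
move=> fM; have bf : bounded_fun f by apply/bounded_funP; exists M.
have intf := integrable_observable Y t bf.
rewrite (le_trans (le_normr_Rintegral _ intf))//.
rewrite (le_trans (le_Rintegral (f2 := cst M) _ _ _ _))//.
- exact: (integrable_norm intf).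
- exact: finite_measure_integrable_cst.
- by rewrite Rintegral_cst// [X in fine X]probability_setT mulr1.
Qed.

(** Used to integrate the Markov property over the whole sample space. *)
Lemma natural_filtrationT (R : realType) (d : measure_display)
    (T : measurableType d) (P : probability T R) (Y : R -> {RV P >-> state})
    (t : R) : natural_filtration Y t setT.
Proof.
by move=> B [[B0 BC _] _]; rewrite -(setD0 setT); exact: BC.
Qed.

(** The error is [E (P_h f - f - h L f)(Y_t)], and the supremum norm of
    [P_h f - f - h L f] is at most [e h] for small [h], whatever the law of
    [Y_t]. *)
Lemma mean_right_derivative (R : realType) (d : measure_display)
    (T : measurableType d) (P : probability T R) (Y : R -> {RV P >-> state})
    (p : R -> R.-pker state ~> state) (L : (state -> R) -> state -> R)
    (f : state -> R) :
    has_generator p L -> markov_property Y p ->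
    bounded_fun f -> bounded_fun (L f) ->
  uniform_right_derivative (mean Y f) (mean Y (L f)).
Proof.
move=> gen mar bf bLf e e0.
have [r /= r0 re] : \forall h \near 0^'+, forall y,
    `|L f y - h^-1 * (semigroup p h f y - f y)| <= e.
  apply: (gen f bf [set g | forall y, `|L f y - g y| <= e]).
  apply/uniform_nbhs.
  exists [set xy : R * R | `|xy.1 - xy.2| <= e].
  split; last by move=> g /= + y; apply.
  rewrite -entourage_ballE; exists e => //= -[x y] /=.
  exact: ltW.
exists r => // t h t0 /andP[h0 hr].
have {}re y : `|semigroup p h f y - f y - h * L f y| <= e * h.
  have /re/(_ h0 y) reh : ball_ Num.norm 0 r h by rewrite /= sub0r normrN gtr0_norm.
  have -> : semigroup p h f y - f y - h * L f y =
      - h * (L f y - h^-1 * (semigroup p h f y - f y)).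
    by field; rewrite gt_eqF.
  by rewrite normrM normrN (gtr0_norm h0) [leRHS]mulrC ler_pM2l.
(* The generator estimate itself bounds [P_h f]. *)
have bph : bounded_fun (semigroup p h f).
  move/bounded_funP : bf => [M fM]; move/bounded_funP : bLf => [N LfN].
  apply/bounded_funP; exists (e * h + M + h * N) => y.
  have -> : semigroup p h f y =
    (semigroup p h f y - f y - h * L f y) + f y + h * L f y by ring.
  rewrite (le_trans (ler_normD _ _))// lerD//.
    by rewrite (le_trans (ler_normD _ _))// lerD.
  by rewrite normrM gtr0_norm// ler_pM2l.
have -> : mean Y f (t + h) = mean Y (semigroup p h f) t.
  exact: (mar _ _ _ _ t0 (ltW h0) bf (@natural_filtrationT _ _ _ _ _ _)).
pose g y := 1 * semigroup p h f y + (-1) * f y.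
have bg : bounded_fun g.
  move/bounded_funP : bf => [M fM]; move/bounded_funP : bph => [N LfN].
  apply/bounded_funP; exists (N + M) => y.
  by rewrite /g mul1r mulN1r (le_trans (ler_normB _ _))// lerD.
have <- : mean Y (fun y => 1 * g y + (- h) * L f y) t =
    mean Y (semigroup p h f) t - mean Y f t - h * mean Y (L f) t.
  by rewrite mean_linear// /g mean_linear// !mul1r mulN1r mulNr.
by apply: mean_le => y; rewrite /g !mul1r mulN1r mulNr.
Qed.

Lemma laplace_mean_integrable (R : realType) (d : measure_display)
    (T : measurableType d) (P : probability T R) (Y : R -> {RV P >-> state})
    (p : R -> R.-pker state ~> state) (L : (state -> R) -> state -> R)
    (f : state -> R) (z : R) :
    has_generator p L -> markov_property Y p ->
    bounded_fun f -> bounded_fun (L f) -> 0 < z ->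
  lebesgue_measure.-integrable `[0, +oo[
    (EFin \o (fun t => mean Y f t * expR (- (z * t)))).
Proof.
move=> gen mar bf bLf z0; have uf := mean_right_derivative gen mar bf bLf.
move/bounded_funP : bf => [M fM]; move/bounded_funP : bLf => [N LfN].
have cf := right_derivative_continuous uf (fun t => mean_le Y t LfN).
exact: (laplace_integrable z0 cf (fun t => mean_le Y t fM)).
Qed.

(** The resolvent form of the Kolmogorov forward equation.  Boundedness of
    [L (L f)] makes the derivative of [E f(Y_t)] continuous. *)
Lemma laplace_generator (R : realType) (d : measure_display)
    (T : measurableType d) (P : probability T R) (Y : R -> {RV P >-> state})
    (p : R -> R.-pker state ~> state) (L : (state -> R) -> state -> R)
    (f : state -> R) (z : R) :
    has_generator p L -> markov_property Y p ->
    (forall g : state -> R, bounded_fun g -> bounded_fun (L g)) ->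
    bounded_fun f -> 0 < z ->
  z * laplace (mean Y f) z - laplace (mean Y (L f)) z = mean Y f 0.
Proof.
move=> gen mar bL bf z0.
have bLf := bL f bf; have bLLf := bL _ bLf.
have uf := mean_right_derivative gen mar bf bLf.
have uLf := mean_right_derivative gen mar bLf bLLf.
move/bounded_funP : bf => [M fM]; move/bounded_funP : bLf => [N LfN].
move/bounded_funP : bLLf => [K LLfK].
have cf := right_derivative_continuous uf (fun t => mean_le Y t LfN).
have cLf := right_derivative_continuous uLf (fun t => mean_le Y t LLfK).
apply: (laplace_derivative z0 cf cLf _ (fun t => mean_le Y t fM)
  (fun t => mean_le Y t LfN)) => t t0.
apply: right_derivative_is_derive => //.
by move/continuous_within_itvcyP : cLf => [+ _]; apply; rewrite in_itv/= andbT.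
Qed.

Lemma bounded_rt_generator (R : realType) (lambda kappa gamma : R)
    (f : state -> R) :
  bounded_fun f -> bounded_fun (rt_generator lambda kappa gamma f).
Proof.
move=> /bounded_funP[M fM]; apply/bounded_funP.
exists (`|lambda| * (M + M) + `|kappa| * (M + M + 2 * M) + `|gamma| * (M + M)).
have fB y y' : `|f y - f y'| <= M + M.
  by rewrite (le_trans (ler_normB _ _))// lerD.
move=> [x v]; rewrite /rt_generator.
rewrite (le_trans (ler_normD _ _))// lerD//; last by rewrite normrM ler_wpM2l.
rewrite (le_trans (ler_normD _ _))// lerD// normrM ler_wpM2l//.
rewrite (le_trans (ler_normB _ _))// lerD//.
  by rewrite (le_trans (ler_normD _ _))// lerD.
by rewrite normrM ger0_norm// ler_wpM2l.
Qed.

Lemma laplace_mean_linear (R : realType) (d : measure_display)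
    (T : measurableType d) (P : probability T R) (Y : R -> {RV P >-> state})
    (a b : R) (f g : state -> R) (z : R) : bounded_fun f -> bounded_fun g ->
    lebesgue_measure.-integrable `[0, +oo[
      (EFin \o (fun t => mean Y f t * expR (- (z * t)))) ->
    lebesgue_measure.-integrable `[0, +oo[
      (EFin \o (fun t => mean Y g t * expR (- (z * t)))) ->
  laplace (mean Y (fun y => a * f y + b * g y)) z =
  a * laplace (mean Y f) z + b * laplace (mean Y g) z.
Proof.
move=> bf bg intf intg; rewrite /laplace -!RintegralZl// -RintegralD//;
  last 2 first.
- exact: (integrableZl _ a intf).
- exact: (integrableZl _ b intg).
by apply: eq_Rintegral => t _; rewrite mean_linear//; ring.
Qed.

(** The two prescribed masses add up to one, so the initial law has no mass
    elsewhere. *)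
Lemma mean_initial (R : realType) (d : measure_display)
    (T : measurableType d) (P : probability T R) (Y : R -> {RV P >-> state})
    (a b : state) (alpha : R) (f : state -> R) : a != b ->
    P [set w | Y 0 w = a] = alpha%:E ->
    P [set w | Y 0 w = b] = (1 - alpha)%:E ->
  bounded_fun f ->
  mean Y f 0 = alpha * f a + (1 - alpha) * f b.
Proof.
move=> ab Pa Pb bf; have intf := integrable_observable Y 0 bf.
pose A := [set w | Y 0 w = a]; pose B := [set w | Y 0 w = b].
have mA : measurable A.
  by rewrite -[A]setTI; apply: (measurable_funP (Y 0) _ [set a]).
have mB : measurable B.
  by rewrite -[B]setTI; apply: (measurable_funP (Y 0) _ [set b]).
have AB0 : A `&` B = set0.
  by apply/seteqP; split => // w [/= wa wb]; move: ab; rewrite -wa -wb eqxx.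
have PC : P (~` (A `|` B)) = 0%E.
  rewrite probability_setC; last exact: measurableU.
  rewrite measureU// [X in (_ - (X + _))%E]Pa [X in (_ - (_ + X))%E]Pb.
  by rewrite -EFinD [alpha + _]addrC subrK subrr.
have mAB : measurable (A `|` B) by exact: measurableU.
have mC : measurable (~` (A `|` B)) by exact: measurableC.
rewrite /mean -(setUv (A `|` B)) Rintegral_setU ?setUv//; last first.
  by apply/disj_set2P; rewrite setICr.
rewrite Rintegral_setU//; last 2 first.
- exact: integrableS intf.
- exact/disj_set2P.
rewrite [X in _ + X](_ : _ = 0); last first.
  rewrite /Rintegral null_set_integral//.
  by have /integrableP[] := integrableS measurableT mC (@subsetT _ _) intf.
rewrite addr0; congr +%R.
- rewrite (@eq_Rintegral _ _ _ _ _ (cst (f a))).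
    by rewrite Rintegral_cst// [X in fine X]Pa mulrC.
  by move=> w; rewrite inE => /= ->.
- rewrite (@eq_Rintegral _ _ _ _ _ (cst (f b))).
    by rewrite Rintegral_cst// [X in fine X]Pb mulrC.
  by move=> w; rewrite inE => /= ->.
Qed.

(** * Fourier modes of the run-and-tumble process *)

Definition vsign (R : realType) (v : bool) : R := (vel v)%:~R.

(** For [s = 1] and [s = vsign], and [trig] the cosine and the sine, these are the
    real and imaginary parts of [e^{iqx}] and [v e^{iqx}]. *)
Definition wave (R : realType) (trig : R -> R) (s : bool -> R) (q : R)
  (y : state) : R := s y.2 * trig (q * y.1%:~R).

Lemma wave_shift (R : realType) (q : R) (x : int) (v : bool) :
  [/\ cos (q * (x + vel v)%:~R) =
        cos q * cos (q * x%:~R) - vsign R v * sin q * sin (q * x%:~R),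
      sin (q * (x + vel v)%:~R) =
        cos q * sin (q * x%:~R) + vsign R v * sin q * cos (q * x%:~R),
      cos (q * (x + 1)%:~R) + cos (q * (x - 1)%:~R) =
        2 * cos q * cos (q * x%:~R) &
      sin (q * (x + 1)%:~R) + sin (q * (x - 1)%:~R) =
        2 * cos q * sin (q * x%:~R)].
Proof.
rewrite /vsign; case: v => /=; rewrite !(intrD, mulrDr) !(cosD, sinD);
  rewrite !(rmorphN, rmorph1) /= ?(mulrN, mulr1) !(cosN, sinN); split; ring.
Qed.

(** On [e^{iqx}] the jumps act by the multiplier [k + i lambda v sin q], whose
    second term exchanges the modes [e^{iqx}] and [v e^{iqx}]; reversal of the
    velocity adds [- 2 gamma] on the odd mode. *)
Lemma rt_generator_wave (R : realType) (lambda kappa gamma q : R) (y : state) :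
  let k := (lambda + 2 * kappa) * (cos q - 1) in
  [/\ rt_generator lambda kappa gamma (wave cos (cst 1) q) y =
        k * wave cos (cst 1) q y + - (lambda * sin q) * wave sin (@vsign R) q y,
      rt_generator lambda kappa gamma (wave sin (cst 1) q) y =
        k * wave sin (cst 1) q y + lambda * sin q * wave cos (@vsign R) q y,
      rt_generator lambda kappa gamma (wave cos (@vsign R) q) y =
        (k - 2 * gamma) * wave cos (@vsign R) q y
        + - (lambda * sin q) * wave sin (cst 1) q y &
      rt_generator lambda kappa gamma (wave sin (@vsign R) q) y =
        (k - 2 * gamma) * wave sin (@vsign R) q y
        + lambda * sin q * wave cos (cst 1) q y].
Proof.
move=> k; rewrite {}/k; case: y => x v.
have [cv sv c2 s2] := wave_shift q x v.
have vN : vsign R (~~ v) = - vsign R v.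
  by case: v {cv sv}; rewrite /vsign/= ?opprK.
have [v1|v1] : vsign R v = 1 \/ vsign R v = -1.
- by case: v {cv sv vN}; [left|right]; rewrite /vsign/= ?rmorphN.
- by rewrite /rt_generator /wave /= vN cv sv -!mulrDr c2 s2 v1; split; ring.
- by rewrite /rt_generator /wave /= vN cv sv -!mulrDr c2 s2 v1; split; ring.
Qed.

Lemma bounded_wave (R : realType) (trig : R -> R) (s : bool -> R) (q : R) :
  (forall x, `|trig x| <= 1) -> (forall v, `|s v| <= 1) ->
  bounded_fun (wave trig s q).
Proof.
move=> trig1 s1; apply/bounded_funP; exists 1 => y.
by rewrite /wave normrM -[leRHS]mulr1 ler_pM.
Qed.

Lemma laplace_rt_generator (R : realType) (lambda kappa gamma a b z : R)
    (d : measure_display) (T : measurableType d) (P : probability T R)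
    (Y : R -> {RV P >-> state}) (f g : state -> R) :
    run_and_tumble lambda kappa gamma Y -> bounded_fun f -> bounded_fun g ->
    (forall y, rt_generator lambda kappa gamma f y = a * f y + b * g y) ->
    0 < z ->
  (z - a) * laplace (mean Y f) z - b * laplace (mean Y g) z = mean Y f 0.
Proof.
move=> [_ [p [_ gen mar]]] bf bg fE z0.
have bL := @bounded_rt_generator R lambda kappa gamma.
have := laplace_generator gen mar bL bf z0.
rewrite (_ : rt_generator _ _ _ f = fun y => a * f y + b * g y); last exact/funext.
rewrite laplace_mean_linear//; first by move=> <-; ring.
- exact: laplace_mean_integrable gen mar bf (bL _ bf) z0.
- exact: laplace_mean_integrable gen mar bg (bL _ bg) z0.
Qed.

Lemma FL_integrandE (R : realType)
    (d : measure_display) (T : measurableType d) (P : probability T R)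
    (Y : R -> {RV P >-> state}) (q z t : R) :
  FL_integrand Y q z t =
    (mean Y (wave cos (cst 1) q) t * expR (- (z * t))) +i*
    (mean Y (wave sin (cst 1) q) t * expR (- (z * t))).
Proof.
have phase (x : R) : cexp ('i%C * x%:C) = cos x +i* sin x.
  rewrite /cexp /= (_ : 0 * x - 1 * 0 = 0); last by ring.
  by rewrite (_ : 0 * 0 + 1 * x = x) ?expR0 ?mul1r//; ring.
rewrite /FL_integrand /char_fun /cintegral.
under eq_Rintegral do rewrite phase /=.
under [X in _ +i* X]eq_Rintegral do rewrite phase /=.
simpc; rewrite /mean /wave.
by congr (_ * _ +i* (_ * _)); apply: eq_Rintegral => w _; rewrite /= mul1r.
Qed.

Theorem mainTheorem3 (R : realType) (lambda kappa gamma alpha : R)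
    (hlambda : 0 <= lambda) (hkappa : 0 <= kappa) (hgamma : 0 < gamma)
    (halpha : 0 <= alpha <= 1)
    (d : measure_display) (T : measurableType d) (P : probability T R)
    (Y : R -> {RV P >-> state})
    (hY : run_and_tumble lambda kappa gamma Y)
    (hY0p : P [set w | Y 0 w = (0, true)] = alpha%:E)
    (hY0m : P [set w | Y 0 w = (0, false)] = (1 - alpha)%:E)
    (q z : R) (hz : 0 < z) :
  [/\ cintegrable (@lebesgue_measure R) `[0, +oo[ (FL_integrand Y q z),
      fourier_laplace Y q z =
        ('i%C * (lambda * (2 * alpha - 1) * sin q)%:C
         + (2 * gamma + z - (lambda + 2 * kappa) * (cos q - 1))%:C)
        / ((gamma + z - (lambda + 2 * kappa) * (cos q - 1)) ^+ 2
           - gamma ^+ 2 + lambda ^+ 2 * (sin q) ^+ 2)%:C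
    & alpha = 1 / 2 ->
      fourier_laplace Y q z =
        (2 * gamma + z - (lambda + 2 * kappa) * (cos q - 1))%:C
        / ((gamma + z - (lambda + 2 * kappa) * (cos q - 1)) ^+ 2
           - gamma ^+ 2 + lambda ^+ 2 * (sin q) ^+ 2)%:C].
Proof.
set k := (lambda + 2 * kappa) * (cos q - 1).
have one1 (v : bool) : `|(cst 1 : bool -> R) v| <= 1 by rewrite /= normr1.
have sgn1 (v : bool) : `|vsign R v| <= 1.
  by case: v; rewrite /vsign/= ?rmorphN ?normrN normr1.
have cos1 (x : R) : `|cos x| <= 1 := cos_max x.
have sin1 (x : R) : `|sin x| <= 1 := sin_max x.
have bC := bounded_wave q cos1 one1; have bS := bounded_wave q sin1 one1.
have bVC := bounded_wave q cos1 sgn1; have bVS := bounded_wave q sin1 sgn1.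
have [p [_ gen mar]] := hY.2.
have bL := @bounded_rt_generator R lambda kappa gamma.
have intC := laplace_mean_integrable gen mar bC (bL _ bC) hz.
have intS := laplace_mean_integrable gen mar bS (bL _ bS) hz.
have FLE : FL_integrand Y q z = fun t => _ := funext (FL_integrandE Y q z).
pose C := laplace (mean Y (wave cos (cst 1) q)) z.
pose S := laplace (mean Y (wave sin (cst 1) q)) z.
pose VC := laplace (mean Y (wave cos (@vsign R) q)) z.
pose VS := laplace (mean Y (wave sin (@vsign R) q)) z.
have start f : bounded_fun f ->
    mean Y f 0 = alpha * f (0, true) + (1 - alpha) * f (0, false).
  exact: mean_initial.
(* The four resolvent equations couple [C] with [VS] and [S] with [VC] only. *)
have eC : (z - k) * C + lambda * sin q * VS = 1.
  have := laplace_rt_generator hY bC bVS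
    (fun y => let: And4 e _ _ _ := rt_generator_wave lambda kappa gamma q y in e) hz.
  rewrite start// /wave /= mulr0 cos0 mulNr opprK => ->.
  by ring.
have eS : (z - k) * S - lambda * sin q * VC = 0.
  have := laplace_rt_generator hY bS bVC
    (fun y => let: And4 _ e _ _ := rt_generator_wave lambda kappa gamma q y in e) hz.
  rewrite start// /wave /= mulr0 sin0 => ->.
  by ring.
have eVC : (z - k + 2 * gamma) * VC + lambda * sin q * S = 2 * alpha - 1.
  have := laplace_rt_generator hY bVC bS
    (fun y => let: And4 _ _ e _ := rt_generator_wave lambda kappa gamma q y in e) hz.
  rewrite start// /wave /= mulr0 cos0 /vsign /= rmorphN rmorph1 mulNr opprK opprB.
  rewrite addrA -/k [z + _ - k]addrAC => ->.
  by ring.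
have eVS : (z - k + 2 * gamma) * VS - lambda * sin q * C = 0.
  have := laplace_rt_generator hY bVS bC
    (fun y => let: And4 _ _ _ e := rt_generator_wave lambda kappa gamma q y in e) hz.
  rewrite start// /wave /= mulr0 sin0 opprB addrA -/k [z + _ - k]addrAC => ->.
  by ring.
have k0 : k <= 0.
  by rewrite mulr_ge0_le0 ?subr_le0 ?cos_le1// addr_ge0// mulr_ge0.
set den := _ + lambda ^+ 2 * _.
have denE : den = (z - k) * (z - k + 2 * gamma) + (lambda * sin q) ^+ 2.
  by rewrite /den; ring.
have den0 : 0 < den.
  by rewrite denE ltr_pwDl ?sqr_ge0// mulr_gt0//; lra.
(* Each pair of equations is solved by eliminating [VS], resp. [VC]. *)
have CE : C * den = 2 * gamma + z - k.
  have -> : 2 * gamma + z - k =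
      (z - k + 2 * gamma) * ((z - k) * C + lambda * sin q * VS).
    by rewrite eC; ring.
  have -> : (z - k + 2 * gamma) * ((z - k) * C + lambda * sin q * VS) =
      (z - k + 2 * gamma) * (z - k) * C
      + lambda * sin q * ((z - k + 2 * gamma) * VS) by ring.
  by rewrite (subr0_eq eVS) denE; ring.
have SE : S * den = lambda * (2 * alpha - 1) * sin q.
  rewrite -eVC denE.
  have -> : lambda * ((z - k + 2 * gamma) * VC + lambda * sin q * S) * sin q =
    (z - k + 2 * gamma) * (lambda * sin q * VC)
    + lambda * sin q * (lambda * sin q * S) by ring.
  by rewrite -(subr0_eq eS); ring.
have FL : fourier_laplace Y q z =
    ('i%C * (lambda * (2 * alpha - 1) * sin q)%:C + (2 * gamma + z - k)%:C) / den%:C.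
  have denC : den%:C != 0 :> R[i] by rewrite eq_complex /= eqxx andbT gt_eqF.
  apply: (canRL (mulfK denC)).
  have -> : fourier_laplace Y q z = C +i* S.
    by rewrite /fourier_laplace /cintegral FLE.
  by rewrite -CE -SE; simpc.
split => //.
  by rewrite /cintegrable FLE; split.
move=> a2; rewrite FL a2.
have -> : 2 * (1 / 2) - 1 = 0 :> R by field.
by rewrite mulr0 mul0r mulr0 add0r.
Qed.
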